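(* Let $\beta=0$ and let $\nu\ge 0$ be real. For $t>0$, the number $\lambda=it$ is an eigenvalue for some $\eta>0$, i.e. there exists $\eta>0$ such that $$\vartheta\lambda+G_{0,\nu}(\lambda)=0\quad\text{with } \lambda=it,\ \vartheta=\eta\,G_{0,\nu}(0),$$ if and only if $$\tan^{-1}t=\omega_k:=\frac{\pi}{2}\,\frac{1+4k}{1+\nu}\quad\text{for some integer } k \text{ satisfying } 0\le 4k<\nu .$$ Moreover, for every such $k$, with $t_k=\tan\omega_k$ and $\vartheta_k=-G_{0,\nu}(it_k)/(it_k)>0$, the transversal crossing condition $$\frac{d}{dt}\operatorname{Re}G_{0,\nu}(it)\Big|_{t=t_k}\ne 0$$ holds, and the branch $\lambda=\lambda(\vartheta)$ of solutions of $\vartheta\lambda+G_{0,\nu}(\lambda)=0$ with $\lambda(\vartheta_k)=it_k$ satisfies $\operatorname{Re}\frac{d\lambda}{d\vartheta}<0$ at $\vartheta=\vartheta_k$.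
   Context: For real $\beta\ge0$, $\nu\ge0$ and complex $\lambda$ for which the integral converges, define $$G_{\beta,\nu}(\lambda)=\int_0^\infty \exp\Bigl(-\frac{1}{\beta+1}z^{\beta+1}-\lambda z\Bigr)z^{\nu}\,dz .$$ For $\beta=0$ this is $G_{0,\nu}(\lambda)=\int_0^\infty e^{-(1+\lambda)z}z^\nu\,dz$, defined and analytic for $\operatorname{Re}\lambda>-1$. Given $\eta>0$, an ''eigenvalue'' means a solution $\lambda\in\mathbb{C}$ of $\vartheta\lambda+G_{\beta,\nu}(\lambda)=0$ with $\vartheta=\eta^{\frac1{\beta+1}}G_{\beta,\nu}(0)$, so $\vartheta=\eta\,G_{0,\nu}(0)$ when $\beta=0$. (This is the characteristic equation, after rescaling the growth rate by the factor $\eta^{-1/(\beta+1)}$, for the linearization about the steady state of the system $\partial_\tau u=1-\int_0^\infty h z^\nu dz$, $\partial_\tau h+\partial_z h=-\eta z^\beta h$ for $z>0$, $h(0,\tau)=e^{u(\tau)}$.) Here $\tan^{-1}$ is the principal arctangent, with values in $(-\pi/2,\pi/2)$. The branch $\lambda(\vartheta)$ is the differentiable solution curve, defined for real $\vartheta$ near $\vartheta_k$, passing through $it_k$ at $\vartheta=\vartheta_k$. *)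

(* Defs.v *)
From HB Require Import structures.
From mathcomp Require Import all_boot all_order all_algebra.
From mathcomp Require Import complex.
From mathcomp Require Import all_classical all_reals all_analysis.

Set Implicit Arguments.
Unset Strict Implicit.
Unset Printing Implicit Defensive.

Import Order.TTheory GRing.Theory Num.Theory.
Import numFieldNormedType.Exports.

Local Open Scope classical_set_scope.
Local Open Scope ring_scope.
Local Open Scope complex_scope.

Definition cexp (R : realType) (w : R[i]) : R[i] :=
  (expR (complex.Re w))%:C * (cos (complex.Im w) +i* sin (complex.Im w)).

(* R[i] carries no R-normed-module structure, so derivatives and integrals of
   C-valued functions of a real variable are taken componentwise. *)
Definition cderivable (R : realType) (f : R -> R[i]) (x : R) : Prop :=
  derivable (fun y => complex.Re (f y)) x 1 /\
  derivable (fun y => complex.Im (f y)) x 1.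

Definition cderive1 (R : realType) (f : R -> R[i]) (x : R) : R[i] :=
  derive1 (fun y => complex.Re (f y)) x +i* derive1 (fun y => complex.Im (f y)) x.

Definition cintegrable (R : realType) (D : set R) (f : R -> R[i]) : Prop :=
  lebesgue_measure.-integrable D (fun z => (complex.Re (f z))%:E) /\
  lebesgue_measure.-integrable D (fun z => (complex.Im (f z))%:E).

Definition cintegral (R : realType) (D : set R) (f : R -> R[i]) : R[i] :=
  (\int[lebesgue_measure]_(z in D) complex.Re (f z))%R +i*
  (\int[lebesgue_measure]_(z in D) complex.Im (f z))%R.

Definition G_integrand (R : realType) (beta nu : R) (lam : R[i]) (z : R) : R[i] :=
  cexp (- ((beta + 1)^-1 * z `^ (beta + 1))%:C - lam * z%:C) * (z `^ nu)%:C.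

(* For beta, nu >= 0 the improper integral converges exactly when it converges
   absolutely: for every lam if beta > 0, and for Re lam > -1 if beta = 0. *)
Definition G_converges (R : realType) (beta nu : R) (lam : R[i]) : Prop :=
  cintegrable `[0, +oo[ (G_integrand beta nu lam).

(* Only meaningful when [G_converges beta nu lam]. *)
Definition G (R : realType) (beta nu : R) (lam : R[i]) : R[i] :=
  cintegral `[0, +oo[ (G_integrand beta nu lam).

Definition char_solution (R : realType) (beta nu : R) (theta lam : R[i]) : Prop :=
  G_converges beta nu lam /\ theta * lam + G beta nu lam = 0.

Definition vartheta (R : realType) (beta nu eta : R) : R[i] :=
  (eta `^ (beta + 1)^-1)%:C * G beta nu 0.

Definition is_eigenvalue (R : realType) (beta nu eta : R) (lam : R[i]) : Prop :=
  char_solution beta nu (vartheta beta nu eta) lam.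

Definition is_branch (R : realType) (beta nu theta0 : R) (lam0 : R[i])
    (lam : R -> R[i]) : Prop :=
  lam theta0 = lam0 /\
  \forall theta \near theta0,
    cderivable lam theta /\ char_solution beta nu theta%:C (lam theta).

Definition omega (R : realType) (nu : R) (k : int) : R :=
  pi / 2 * ((1 + 4 * k%:~R) / (1 + nu)).

Definition t_ (R : realType) (nu : R) (k : int) : R := tan (omega nu k).

Definition theta_ (R : realType) (nu : R) (k : int) : R[i] :=
  - G 0 nu (0 +i* t_ nu k) / (0 +i* t_ nu k).

(* Main.v *)
Require Import Defs.
From mathcomp Require Import all_boot all_order all_algebra.
From mathcomp Require Import complex.
From mathcomp Require Import all_classical all_reals all_analysis.
From mathcomp Require Import measurable_realfun ring lra.
Import Order.TTheory GRing.Theory Num.Theory.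
Import numFieldNormedType.Exports.
Local Open Scope classical_set_scope.
Local Open Scope ring_scope.
Local Open Scope complex_scope.

(** Write s = 1 + lambda = r e^(iw) with r > 0 and |w| < pi/2. The integral is
    G(lambda) = Gamma(nu+1) s^-(nu+1), because its integration ray can be turned:
    once the factor s^(nu+1) is included, the w-derivative of the integrand is
    the z-derivative of a function vanishing at both ends of the half-line
    ([is_derive_rotated], [is_derive_rotated_prim], [integral_rotated]).
    This gives the closed form [G_polar].

    On the imaginary axis w = atan t, and the real part of the characteristic
    equation says cos((nu+1)w) = 0 while the imaginary part fixes the sign of
    sin((nu+1)w); hence (nu+1)w = pi/2 + 2 pi k, and w < pi/2 bounds k. At such a
    point Re G(it) is a positive multiple of cos((nu+1) atan t), which crosses 0
    with negative slope.

    For real theta > 0 the two real equations in (r, w) can be solved explicitly: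
    eliminating theta leaves r sin((nu+2)w) = sin((nu+1)w), so near a crossing
    the whole solution set is a curve parametrised by the angle w, with
      theta = Gamma(nu+1) r^-(nu+1) sin((nu+2)w) / sin w,
      lambda = - e^(-i(nu+1)w) sin w / sin((nu+2)w)
    ([polar_char_curve]). At a crossing theta has negative w-derivative, so w is
    locally a differentiable function of theta ([local_inverse]); this gives
    existence and uniqueness of the branch with one-variable calculus only. There
    Re lambda has positive w-derivative, and the quotient of the two derivatives
    is the negative number d(Re lambda)/d(theta) ([hopf_branch]). *)

Set Implicit Arguments.
Unset Strict Implicit.
Unset Printing Implicit Defensive.

(** * Derivative rules for functions given by formulas *)

Section Derivatives.
Context {R : realType}.
Implicit Types (f g : R -> R) (x a b c : R).

(** The rules below are stated for functions written as lambda-abstractions, so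
    that they apply by higher-order pattern matching and leave the derivative in
    the form given by the rule. *)
Lemma is_derive_constF c x : is_derive x 1 (fun _ : R => c) 0.
Proof. exact: is_derive_cst. Qed.

Lemma is_derive_idF x : is_derive x 1 (fun y : R => y) 1.
Proof. exact: is_derive_id. Qed.

Lemma is_deriveDF f g x a b : is_derive x 1 f a -> is_derive x 1 g b ->
  is_derive x 1 (fun y => f y + g y) (a + b).
Proof. by move=> fa gb; exact: is_deriveD. Qed.

Lemma is_deriveNF f x a : is_derive x 1 f a ->
  is_derive x 1 (fun y => - f y) (- a).
Proof. by move=> fa; exact: is_deriveN. Qed.

Lemma is_deriveMF f g x a b : is_derive x 1 f a -> is_derive x 1 g b ->
  is_derive x 1 (fun y => f y * g y) (a * g x + f x * b).
Proof.
move=> fa gb; apply: (is_derive_eq (is_deriveM fa gb)).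
by rewrite addrC /GRing.scale/= [g x * a]mulrC.
Qed.

Lemma is_derive_compF f g x a b : is_derive (g x) 1 f a ->
  is_derive x 1 g b -> is_derive x 1 (fun y => f (g y)) (a * b).
Proof. by move=> fa gb; exact: is_derive1_comp. Qed.

Lemma is_derive_expRF g x b : is_derive x 1 g b ->
  is_derive x 1 (fun y => expR (g y)) (expR (g x) * b).
Proof. exact: is_derive_compF. Qed.

Lemma is_derive_sinF g x b : is_derive x 1 g b ->
  is_derive x 1 (fun y => sin (g y)) (cos (g x) * b).
Proof. exact: is_derive_compF. Qed.

Lemma is_derive_cosF g x b : is_derive x 1 g b ->
  is_derive x 1 (fun y => cos (g y)) (- sin (g x) * b).
Proof. exact: is_derive_compF. Qed.

Lemma is_derive_lnF g x b : 0 < g x -> is_derive x 1 g b ->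
  is_derive x 1 (fun y => ln (g y)) ((g x)^-1 * b).
Proof. by move=> gx0; apply: is_derive_compF; exact: is_derive1_ln. Qed.

Lemma is_derive_invF g x b : g x != 0 -> is_derive x 1 g b ->
  is_derive x 1 (fun y => (g y)^-1) (- (g x ^- 2) * b).
Proof. by move=> gx0 gb; exact: is_deriveV. Qed.

Lemma is_derive_derivable (f : R -> R) (x a : R) :
  is_derive x 1 f a -> derivable f x 1.
Proof. by move=> fa; exact: ex_derive. Qed.

Lemma derivable_continuous (f : R -> R) (x : R) :
  derivable f x 1 -> {for x, continuous f}.
Proof. by move=> ?; apply: differentiable_continuous; apply/derivable1_diffP. Qed.

Lemma is_derive_continuous f x a : is_derive x 1 f a -> {for x, continuous f}.
Proof. by move/is_derive_derivable; exact: derivable_continuous. Qed.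

End Derivatives.

(* Rules are applied with class inference switched off: otherwise it fills the
   premises with unreduced derivatives. *)
Ltac derive_rules := repeat (first
  [ exact: is_derive_constF | exact: is_derive_idF
  | notypeclasses refine (is_deriveDF _ _)
  | notypeclasses refine (is_deriveNF _)
  | notypeclasses refine (is_deriveMF _ _)
  | notypeclasses refine (is_derive_expRF _)
  | notypeclasses refine (is_derive_sinF _)
  | notypeclasses refine (is_derive_cosF _) ]).

Ltac derive_by_rules :=
  notypeclasses refine (is_derive_eq _ _); [derive_rules | move=> /=].

(** * Integrands dominated by a decaying exponential *)

Section ExponentialDomination.
Context {R : realType}.
Local Notation mu := (@lebesgue_measure R).
Implicit Types (f F : R -> R) (C d m : R).

(** From 1 + x <= exp x at x = d z / m, raised to the power m; the constant is
    (m/d)^m. *)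
Lemma powR_le_expR m d : 0 <= m -> 0 < d ->
  exists2 C, 0 <= C & forall z, 0 <= z -> z `^ m <= C * expR (d * z).
Proof.
move=> m0 d0; have [->|mn0] := eqVneq m 0.
  exists 1 => // z z0; rewrite powRr0 mul1r -expR0 ler_expR.
  by rewrite mulr_ge0 // ltW.
have m_gt0 : 0 < m by rewrite lt_neqAle eq_sym mn0.
exists ((m / d) `^ m); first exact: powR_ge0.
move=> z z0.
have md0 : 0 <= m / d by rewrite divr_ge0 // ltW.
have -> : d * z = (d * z / m) * m by field.
rewrite expRM -powRM ?expR_ge0 //.
apply: ge0_ler_powR; rewrite ?nnegrE //.
  by rewrite mulr_ge0 // expR_ge0.
have {1}-> : z = m / d * (d * z / m) by field; rewrite mn0 gt_eqF.
rewrite ler_wpM2l //; apply: le_trans (expR_ge1Dx _).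
by rewrite lerDr.
Qed.

Lemma continuous_expR_decay C d : continuous (fun z : R => C * expR (- (d * z))).
Proof.
move=> z; apply: is_derive_continuous; derive_rules.
Qed.

Lemma cvg_expR_decay C d : 0 < d ->
  C * expR (- (d * z)) @[z --> +oo] --> (0 : R).
Proof.
move=> d0; rewrite -(mulr0 C); apply: cvgMl_tmp.
apply: (cvg_comp (fun z => d * z) (fun x => expR (- x))); last exact: cvgr_expR.
by apply: gt0_cvgMry => //; exact: cvg_id.
Qed.

Lemma integral_expR_decay C d : 0 <= C -> 0 < d ->
  (\int[mu]_(z in `[0%R, +oo[) (C * expR (- (d * z)))%:E = (C / d)%:E)%E.
Proof.
move=> C0 d0.
rewrite (@ge0_continuous_FTC2y _ _ (fun z => - (C / d) * expR (- (d * z))) 0 0).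
- by rewrite mulr0 oppr0 expR0 mulr1 sub0e EFinN oppeK.
- by move=> z _; rewrite mulr_ge0 // expR_ge0.
- apply: continuous_subspaceT; exact: continuous_expR_decay.
- exact: cvg_expR_decay.
- move=> x _; apply: ex_derive; derive_rules.
- by apply: cvg_at_right_filter; exact: continuous_expR_decay.
- move=> x _; rewrite derive1E; apply: derive_val.
  derive_by_rules.
  by field; rewrite gt_eqF.
Qed.

Lemma integrable_expR_decay C d : 0 <= C -> 0 < d ->
  mu.-integrable `[0, +oo[ (fun z => (C * expR (- (d * z)))%:E).
Proof.
move=> C0 d0.
have ge0 z : 0 <= C * expR (- (d * z)) by rewrite mulr_ge0 // expR_ge0.
apply/integrableP; split.
  apply/measurable_EFinP. apply: measurable_funTS. apply: continuous_measurable_fun.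
  exact: continuous_expR_decay.
under eq_integral do rewrite gee0_abs ?lee_fin //.
by rewrite integral_expR_decay // ltry.
Qed.

Lemma integrable_expR_dominated f C d : 0 <= C -> 0 < d ->
  measurable_fun (`[0, +oo[ : set R) f ->
  (forall z : R, 0 <= z -> `|f z| <= C * expR (- (d * z))) ->
  mu.-integrable `[0, +oo[ (fun z => (f z)%:E).
Proof.
move=> C0 d0 mf fC; apply: le_integrable (integrable_expR_decay C0 d0) => //.
  exact/measurable_EFinP.
move=> z /=; rewrite in_itv/= andbT => z0.
by rewrite lee_fin [leRHS]ger0_norm ?fC // mulr_ge0 // expR_ge0.
Qed.

(** Adding the dominating exponential, whose integral is known, makes the
    integrand nonnegative, and for nonnegative integrands the fundamental theorem
    on a half-line follows by monotone convergence. *)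
Lemma expR_dominated_FTC2y f F C d : 0 <= C -> 0 < d ->
  (forall z : R, 0 <= z -> `|f z| <= C * expR (- (d * z))) ->
  {within `[0, +oo[, continuous f} ->
  F z @[z --> +oo] --> (0 : R) -> F z @[z --> 0^'+] --> F 0 ->
  (forall z : R, 0 < z -> is_derive z 1 F (f z)) ->
  \int[mu]_(z in `[0, +oo[) f z = - F 0.
Proof.
move=> C0 d0 fC cf Foo F0 dF.
pose g (z : R) : R := C * expR (- (d * z)).
pose G (z : R) : R := - (C / d) * expR (- (d * z)).
have intg : mu.-integrable `[0, +oo[ (EFin \o g) by exact: integrable_expR_decay.
have mf : measurable_fun (`[0, +oo[ : set R) f.
  by apply: subspace_continuous_measurable_fun.
have intf : mu.-integrable `[0, +oo[ (EFin \o f).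
  exact: integrable_expR_dominated fC.
have cg : {within `[0, +oo[, continuous g}.
  by apply: continuous_subspaceT; exact: continuous_expR_decay.
have dG (z : R) : is_derive z 1 G (g z).
  by derive_by_rules; rewrite /g; field; rewrite gt_eqF.
have iG : \int[mu]_(z in `[0, +oo[) g z = C / d.
  by rewrite /Rintegral integral_expR_decay.
have -> : \int[mu]_(z in `[0, +oo[) f z =
    \int[mu]_(z in `[0, +oo[) (f z + g z) - \int[mu]_(z in `[0, +oo[) g z.
  by rewrite RintegralD // addrK.
rewrite (@Rintegral_ge0_continuous_FTC2y _ _ (fun z => F z + G z) 0 0).
- by rewrite iG /G mulr0 oppr0 expR0; ring.
- move=> z z0; rewrite -lerBlDr sub0r.
  by move: (fC z z0); rewrite ler_norml => /andP[].
- by move=> z; apply: cvgD; [exact: cf|exact: cg].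
- rewrite -[X in _ --> X]addr0; apply: cvgD => //; exact: cvg_expR_decay.
- by move=> z z0; apply: ex_derive; apply: is_deriveDF => //; exact: dF.
- by apply: cvgD => //; apply: cvg_at_right_filter; exact: continuous_expR_decay.
- move=> z; rewrite in_itv/= andbT => z0; rewrite derive1E.
  by apply: derive_val; apply: is_deriveDF => //; exact: dF.
Qed.

Lemma cvg0_expR_dominated (F : R -> R) (C d : R) : 0 < d ->
  (forall z : R, 0 <= z -> `|F z| <= C * expR (- (d * z))) ->
  F z @[z --> +oo] --> (0 : R).
Proof.
move=> d0 FC; apply: norm_cvg0.
apply: (@squeeze_cvgr _ _ _ _ (cst 0) (fun z => C * expR (- (d * z)))).
- near=> z; rewrite /= normr_ge0 FC //; near: z; exact: nbhs_pinfty_ge.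
- exact: cvg_cst.
- exact: cvg_expR_decay.
Unshelve. all: end_near. Qed.

(** Half of the exponential rate absorbs the power. The constant is uniform in the
    rates above c, as needed to differentiate under the integral sign. *)
Lemma powR_expR_decay (m c : R) : 0 <= m -> 0 < c ->
  exists2 C, 0 <= C & forall c' z : R, c <= c' -> 0 <= z ->
    z `^ m * expR (- (c' * z)) <= C * expR (- (c / 2 * z)).
Proof.
move=> m0 c0; have c20 : 0 < c / 2 by rewrite divr_gt0.
have [C C0 hC] := powR_le_expR m0 c20; exists C => // c' z cc' z0.
apply: (@le_trans _ _ (C * expR (c / 2 * z) * expR (- (c * z)))).
  apply: ler_pM; rewrite ?powR_ge0 ?expR_ge0 ?hC //.
  by rewrite ler_expR lerN2 ler_wpM2r.
rewrite -mulrA -expRD ler_wpM2l // ler_expR.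
by rewrite le_eqVlt; apply/orP; left; apply/eqP; field.
Qed.

Lemma continuous_powR_ge0 (a : R) : 0 <= a ->
  {within `[0, +oo[, continuous (fun z : R => z `^ a)}.
Proof.
rewrite le_eqVlt => /predU1P[<-|a0].
  rewrite (_ : (fun z : R => _) = cst 1); last by apply/funext => z; exact: powRr0.
  by apply: continuous_subspaceT => z; exact: cvg_cst.
apply/continuous_within_itvcyP; split.
  move=> z; rewrite in_itv/= andbT => z0.
  by apply: is_derive_continuous; exact: is_derive1_powR.
by rewrite powR0 ?gt_eqF //; exact: powR_cvg0.
Qed.

Lemma integrable_gamma (nu r : R) : 0 <= nu -> 0 < r ->
  mu.-integrable `[0, +oo[ (fun z : R => (z `^ nu * expR (- (r * z)))%:E).
Proof.
move=> nu0 r0; have [C C0 hC] := powR_expR_decay nu0 r0.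
apply: (@integrable_expR_dominated _ C (r / 2)) => //.
- by rewrite divr_gt0.
- apply: measurable_funTS; apply: measurable_funM; first exact: measurable_powR.
  apply: continuous_measurable_fun => z.
  by apply: is_derive_continuous; derive_rules.
- move=> z z0; rewrite ger0_norm ?mulr_ge0 ?powR_ge0 ?expR_ge0 //.
  exact: hC.
Qed.

End ExponentialDomination.

(** * Turning the ray of integration *)

Section Rotation.
Context {R : realType}.
Local Notation mu := (@lebesgue_measure R).

Lemma cos_ge_cos (h w : R) : 0 <= h <= pi -> `|w| <= h -> cos h <= cos w.
Proof.
move=> /andP[h0 hpi] wh; rewrite -(cos_norm w).
by rewrite leNgt ltr_cos -?leNgt // in_itv/= ?normr_ge0 ?h0 ?hpi ?(le_trans wh).
Qed.

Variables (nu r psi : R).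
Hypotheses (nu0 : 0 <= nu) (r0 : 0 < r).

(** With s = r e^(iw), [rotated w z] is the real part of
    e^(-i psi) e^(i(nu+1)w) z^nu e^(-sz), [drotated w z] its derivative in w, and
    [rotated_prim w z] a primitive in z of that derivative. The phase psi gives
    access to both the real and the imaginary part of the integral. *)
Definition rotated_phase (w z : R) : R := r * sin w * z + psi - (nu + 1) * w.

Definition rotated (w z : R) : R :=
  z `^ nu * expR (- (r * cos w * z)) * cos (rotated_phase w z).

Definition drotated (w z : R) : R :=
  z `^ nu * expR (- (r * cos w * z)) *
  ((nu + 1) * sin (rotated_phase w z) - r * z * sin (rotated_phase w z - w)).

Definition rotated_prim (w z : R) : R :=
  z `^ (nu + 1) * expR (- (r * cos w * z)) * sin (rotated_phase w z).

Lemma is_derive_rotated (w z : R) : is_derive w 1 (rotated ^~ z) (drotated w z).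
Proof.
rewrite /rotated /drotated /rotated_phase; derive_by_rules.
by rewrite sinB; ring.
Qed.

Lemma powR_succ (z : R) : 0 <= z -> z `^ (nu + 1) = z * z `^ nu.
Proof.
move=> z0; have n1 : nu + 1 != 0 by rewrite gt_eqF // ltr_wpDl.
by rewrite powRD ?(negbTE n1) // powRr1 // mulrC.
Qed.

(** The same [drotated] as in [is_derive_rotated]: d/dw of e^(i(nu+1)w) z^nu e^(-sz)
    is d/dz of i e^(i(nu+1)w) z^(nu+1) e^(-sz). *)
Lemma is_derive_rotated_prim (w z : R) : 0 < z -> is_derive z 1 (rotated_prim w) (drotated w z).
Proof.
move=> z0; rewrite /rotated_prim /drotated /rotated_phase.
notypeclasses refine (is_derive_eq _ _).
  notypeclasses refine (is_deriveMF _ _); last by derive_rules.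
  notypeclasses refine (is_deriveMF _ _); last by derive_rules.
  exact: is_derive1_powR.
by rewrite /= addrK powR_succ 1?ltW // sinB; ring.
Qed.

(** Domination is needed uniformly for angles near w0; on ]-h, h[ with h < pi/2 the
    decay rate r cos w is at least r cos h > 0. *)
Lemma rotated_bounds (w0 : R) : - (pi / 2) < w0 < pi / 2 ->
  exists h C d : R, [/\ w0 \in `]-h, h[, 0 <= C, 0 < d &
    forall w z : R, w \in `]-h, h[ -> 0 <= z ->
    [/\ `|rotated w z| <= C * expR (- (d * z)),
        `|drotated w z| <= C * expR (- (d * z)) &
        `|rotated_prim w z| <= C * expR (- (d * z))]].
Proof.
move=> /andP[w1 w2]; have w0h : `|w0| < pi / 2 by rewrite ltr_norml w1.
have pi0 := @pi_gt0 R; have nw0 := normr_ge0 w0.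
pose h := (`|w0| + pi / 2) / 2.
have [h0 hpi w0h' h2] : [/\ 0 <= h, h <= pi, `|w0| < h & h < pi / 2].
  by rewrite /h; split; lra.
have c0 : 0 < r * cos h.
  by rewrite mulr_gt0 // cos_gt0_pihalf // h2 andbT; lra.
have n10 : 0 <= nu + 1 by rewrite addr_ge0.
have [C1 C10 hC1] := powR_expR_decay nu0 c0.
have [C2 C20 hC2] := powR_expR_decay n10 c0.
exists h, (C1 + ((nu + 1) * C1 + r * C2) + C2), (r * cos h / 2); split.
- by rewrite in_itv/= -ltr_norml.
- by rewrite !addr_ge0 // mulr_ge0 // ltW.
- by rewrite divr_gt0.
move=> w z; rewrite in_itv/= -ltr_norml => /ltW wh z0.
have cw : r * cos h <= r * cos w by rewrite ler_wpM2l ?cos_ge_cos ?h0 // ltW.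
have E0 := expR_ge0 (- (r * cos h / 2 * z)).
have e0 := expR_ge0 (- (r * cos w * z)).
have b1 := hC1 _ z cw z0; have b2 := hC2 _ z cw z0.
have p1 : 0 <= z `^ nu by exact: powR_ge0.
have p2 : 0 <= z `^ (nu + 1) by exact: powR_ge0.
have B1 : 0 <= C1 * expR (- (r * cos h / 2 * z)) by rewrite mulr_ge0.
have B2 : 0 <= C2 * expR (- (r * cos h / 2 * z)) by rewrite mulr_ge0.
have B3 : 0 <= nu * C1 * expR (- (r * cos h / 2 * z)) by rewrite !mulr_ge0.
have B4 : 0 <= r * C2 * expR (- (r * cos h / 2 * z)) by rewrite !mulr_ge0 // ltW.
split.
- rewrite normrM ger0_norm ?mulr_ge0 //.
  apply: (le_trans (ler_piMr _ (cos_max _))); first by rewrite mulr_ge0.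
  by apply: (le_trans b1); lra.
- have -> : drotated w z = (nu + 1) * (z `^ nu * expR (- (r * cos w * z))) *
      sin (rotated_phase w z) -
      r * (z `^ (nu + 1) * expR (- (r * cos w * z))) * sin (rotated_phase w z - w).
    by rewrite /drotated powR_succ //; ring.
  apply: (le_trans (ler_normB _ _)); rewrite !normrM.
  rewrite !(ger0_norm n10) (ger0_norm (ltW r0)) !(ger0_norm p1) (ger0_norm p2) (ger0_norm e0).
  apply: (@le_trans _ _ ((nu + 1) * (C1 * expR (- (r * cos h / 2 * z))) +
                         r * (C2 * expR (- (r * cos h / 2 * z))))); last by lra.
  apply: lerD.
    apply: (le_trans (ler_piMr _ (sin_max _))); first by rewrite !mulr_ge0.
    by rewrite ler_wpM2l.
  apply: (le_trans (ler_piMr _ (sin_max _))); first by rewrite !mulr_ge0 // ltW.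
  by rewrite ler_wpM2l // ltW.
- rewrite normrM ger0_norm ?mulr_ge0 //.
  apply: (le_trans (ler_piMr _ (sin_max _))); first by rewrite mulr_ge0.
  by apply: (le_trans b2); lra.
Qed.

Lemma measurable_rotated (w : R) : measurable_fun setT (rotated w).
Proof.
apply: measurable_funM; first apply: measurable_funM.
- exact: measurable_powR.
- apply: continuous_measurable_fun => z.
  by apply: is_derive_continuous; derive_rules.
- apply: continuous_measurable_fun => z; rewrite /rotated_phase.
  by apply: is_derive_continuous; derive_rules.
Qed.

Lemma continuous_drotated (w : R) : {within `[0, +oo[, continuous (drotated w)}.
Proof.
have cn := continuous_powR_ge0 nu0.
have cE : {within `[0, +oo[, continuous (fun z : R => expR (- (r * cos w * z)))}.
  apply: continuous_subspaceT => z.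
  by apply: is_derive_continuous; derive_rules.
have cS : {within `[0, +oo[, continuous (fun z : R =>
    (nu + 1) * sin (rotated_phase w z) -
    r * z * sin (rotated_phase w z - w))}.
  apply: continuous_subspaceT => z; rewrite /rotated_phase.
  by apply: is_derive_continuous; derive_rules.
by move=> z; apply: cvgM (cS z); apply: cvgM (cn z) (cE z).
Qed.

Lemma rotated_prim_cvg0 (w : R) : rotated_prim w z @[z --> 0^'+] --> rotated_prim w 0.
Proof.
apply: cvgM; first apply: cvgM.
- have n1 : 0 < nu + 1 by rewrite ltr_wpDl.
  by rewrite powR0 ?gt_eqF //; exact: powR_cvg0.
- have c : {for 0, continuous (fun z => expR (- (r * cos w * z)))}.
    by apply: is_derive_continuous; derive_rules.
  exact: cvg_at_right_filter c.
- have c : {for 0, continuous (fun z => sin (rotated_phase w z))}.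
    by rewrite /rotated_phase; apply: is_derive_continuous; derive_rules.
  exact: cvg_at_right_filter c.
Qed.

Lemma integrable_rotated (w : R) : - (pi / 2) < w < pi / 2 ->
  mu.-integrable `[0, +oo[ (fun z => (rotated w z)%:E).
Proof.
move=> /rotated_bounds[h [C [d [wh C0 d0 bnd]]]].
apply: (integrable_expR_dominated C0 d0).
  exact: measurable_funTS (measurable_rotated w).
by move=> z z0; have [] := bnd w z wh z0.
Qed.

(** [drotated] is the z-derivative of [rotated_prim], which vanishes at 0 (the
    exponent nu + 1 is positive) and at infinity. *)
Lemma integral_drotated (w : R) : - (pi / 2) < w < pi / 2 ->
  \int[mu]_(z in `[0, +oo[) drotated w z = 0.
Proof.
move=> /rotated_bounds[h [C [d [wh C0 d0 bnd]]]].
transitivity (- rotated_prim w 0); last first.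
  rewrite /rotated_prim powR0 ?mul0r ?oppr0 //.
  by rewrite gt_eqF // ltr_wpDl.
apply: (@expR_dominated_FTC2y _ _ _ C d) => //.
- by move=> z z0; have [] := bnd w z wh z0.
- exact: continuous_drotated.
- by apply: (cvg0_expR_dominated d0) => z z0; have [_ _] := bnd w z wh z0; exact.
- exact: rotated_prim_cvg0.
- by move=> z z0; exact: is_derive_rotated_prim.
Qed.

Lemma is_derive_integral_rotated (w : R) : - (pi / 2) < w < pi / 2 ->
  is_derive w 1 (fun v => \int[mu]_(z in `[0, +oo[) rotated v z) 0.
Proof.
move=> wpi; have /rotated_bounds[h [C [d [wh C0 d0 bnd]]]] := wpi.
have pdrot v z : partial1of2 rotated v z = drotated v z.
  rewrite partial1of2E; apply: derive_val; exact: is_derive_rotated.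
have wh' : `]-h, h[%classic w by [].
have mI : measurable (`[0, +oo[%classic : set R) by [].
have intf (v : R) : `]-h, h[%classic v -> mu.-integrable `[0, +oo[ (EFin \o rotated v).
  move=> vh; apply: (integrable_expR_dominated C0 d0).
    exact: measurable_funTS (measurable_rotated v).
  by move=> z z0; have [] := bnd v z vh z0.
have derf (v z : R) : `]-h, h[%classic v -> `[0, +oo[%classic z ->
    derivable (rotated ^~ z) v 1.
  by move=> _ _; apply: ex_derive; exact: is_derive_rotated.
have G0 (z : R) : 0 <= C * expR (- (d * z)) by rewrite mulr_ge0 // expR_ge0.
have intG := integrable_expR_decay C0 d0.
have ub (v z : R) : `]-h, h[%classic v -> `[0, +oo[%classic z ->
    `|partial1of2 rotated v z| <= C * expR (- (d * z)).
  rewrite /= => vh; rewrite [z \in _]in_itv/= andbT => z0.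
  by rewrite pdrot; have [] := bnd v z vh z0.
apply: DeriveDef.
  exact: (@derivable_under_integral R _ _ mu rotated _ mI w _ _ wh' intf derf
    (fun z => C * expR (- (d * z))) G0 intG ub).
rewrite -derive1E.
rewrite (@differentiation_under_integral R _ _ mu rotated _ mI w _ _ wh' intf
  derf (fun z => C * expR (- (d * z))) G0 intG ub).
under eq_Rintegral do rewrite pdrot.
exact: integral_drotated.
Qed.

(** The integral has zero derivative in w, so it equals its value at w = 0. *)
Lemma integral_rotated (w : R) : - (pi / 2) < w < pi / 2 ->
  \int[mu]_(z in `[0, +oo[) rotated w z =
  cos psi * \int[mu]_(z in `[0, +oo[) (z `^ nu * expR (- (r * z))).
Proof.
move=> wpi.
(* Composing with atan turns the interval of angles into the whole line, where a
   function with zero derivative is constant. *)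
pose Phi v := \int[mu]_(z in `[0, +oo[) rotated v z.
have -> : \int[mu]_(z in `[0, +oo[) rotated w z = Phi 0.
  have := @is_derive_0_is_cst _ (fun t => Phi (atan t)) (tan w) 0.
  rewrite tanK ?in_itv// atan0; apply => t.
  rewrite -[X in is_derive _ _ _ X](mul0r ((1 + t ^+ 2)^-1)).
  apply: is_derive_compF.
  by apply: is_derive_integral_rotated; rewrite atan_gtNpi2 atan_ltpi2.
have rot0 z : rotated 0 z = cos psi * (z `^ nu * expR (- (r * z))).
  by rewrite /rotated /rotated_phase cos0 sin0 !mulr0 !mulr1 mul0r add0r subr0 mulrC.
rewrite /Phi; under eq_Rintegral do rewrite rot0.
by rewrite RintegralZl //; exact: integrable_gamma.
Qed.

End Rotation.

(** * Closed form of G for beta = 0 *)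

Section ClosedForm.
Context {R : realType}.
Local Notation mu := (@lebesgue_measure R).

(** Euler's Gamma(nu + 1). The factor 1 makes it the case r = 1 of the integrals
    with exponential e^(-rz). *)
Definition Gamma_integral (nu : R) : R :=
  \int[mu]_(z in `[0, +oo[) (z `^ nu * expR (- (1 * z))).

Lemma Gamma_integral_gt0 (nu : R) : 0 <= nu -> 0 < Gamma_integral nu.
Proof.
move=> nu0; have int1 := integrable_gamma nu0 (@ltr01 R).
rewrite /Gamma_integral /Rintegral fine_gt0 //; apply/andP; split; last first.
  by rewrite -ge0_fin_numE ?integral_ge0 //; [exact: integrable_fin_num|
    move=> z _; rewrite lee_fin mulr_ge0 ?powR_ge0 ?expR_ge0].
have /integrableP[mint _] := int1.
(* The integrand is at least e^(-2) on [1, 2]. *)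
have sub : `[1, 2]%classic `<=` (`[0, +oo[%classic : set R).
  move=> z /=; rewrite !in_itv/= andbT => /andP[z1 _]; exact: le_trans z1.
apply: (@lt_le_trans _ _ (\int[mu]_(z in `[1%R, 2%R]) (expR (- 2))%:E)%E).
  rewrite integral_cst //= lebesgue_measure_itv/= lte_fin ltr1n.
  by rewrite -EFinD -EFinM lte_fin mulr_gt0 ?expR_gt0 //; lra.
apply: (@le_trans _ _ (\int[mu]_(z in `[1%R, 2%R]) (z `^ nu * expR (- (1 * z)))%:E)%E).
  apply: ge0_le_integral => //.
  - by apply: measurable_funS sub mint.
  - move=> z /=; rewrite in_itv/= => /andP[z1 z2]; rewrite lee_fin mul1r.
    rewrite -[leLHS]mul1r ler_pM ?expR_ge0 ?ler_expR ?lerN2 //.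
    by rewrite -(powRr0 z) ler_powR.
apply: ge0_subset_integral => //.
by move=> z _; rewrite lee_fin mulr_ge0 ?powR_ge0 ?expR_ge0.
Qed.

(** Substitution of r z for z. *)
Lemma Gamma_integral_scale (nu r : R) : 0 <= nu -> 0 < r ->
  \int[mu]_(z in `[0, +oo[) (z `^ nu * expR (- (r * z))) =
  Gamma_integral nu * r `^ (- (nu + 1)).
Proof.
move=> nu0 r0.
have dF (x : R) : is_derive x 1 (fun x : R => r * x) r.
  by derive_by_rules; ring.
have dFE : derive1 (fun x : R => r * x) = cst r.
  by apply/funext => x; rewrite derive1E; apply: derive_val.
have sub : Gamma_integral nu = \int[mu]_(z in `[0, +oo[)
    (r `^ (nu + 1) * (z `^ nu * expR (- (r * z)))).
  rewrite /Gamma_integral /Rintegral; congr fine.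
  have := @increasing_ge0_integration_by_substitutiony R (fun x => r * x)
    (fun z => z `^ nu * expR (- (1 * z))) 0.
  rewrite mulr0 => -> //.
  - apply: eq_integral => z; rewrite inE/= in_itv/= andbT => z0.
    congr EFin; rewrite dFE fctE/= mul1r powRM ?(ltW r0) //.
    have n1 : nu + 1 != 0 by rewrite gt_eqF // ltr_wpDl.
    rewrite powRD ?(negbTE n1) // powRr1 ?ltW //; ring.
  - by move=> x y _ _ xy; rewrite ltr_pM2l.
  - by rewrite dFE => x _; exact: cvg_cst.
  - by rewrite dFE; exact: is_cvg_cst.
  - by rewrite dFE; exact: is_cvg_cst.
  - split; first by move=> x _; apply: ex_derive; exact: dF.
    have c : {for 0, continuous (fun x : R => r * x)}.
      exact: is_derive_continuous (dF 0).
    exact: cvg_at_right_filter c.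
  - by apply: gt0_cvgMry => //; exact: cvg_id.
  - move=> z; apply: cvgM; first exact: continuous_powR_ge0.
    have c : continuous (fun z : R => expR (- (1 * z))).
      by move=> x; apply: is_derive_continuous; derive_rules.
    by move: z; apply: continuous_subspaceT.
  - by move=> z _; rewrite mulr_ge0 ?powR_ge0 ?expR_ge0.
rewrite sub RintegralZl //; last exact: integrable_gamma.
by rewrite mulrAC powRN divff ?mul1r // gt_eqF // powR_gt0.
Qed.

(** That is, G(lambda) = Gamma(nu+1) (1+lambda)^-(nu+1), with the power taken in
    polar coordinates. *)
Lemma G_polar (nu r w : R) (lam : R[i]) : 0 <= nu -> 0 < r ->
  - (pi / 2) < w < pi / 2 ->
  1 + complex.Re lam = r * cos w -> complex.Im lam = r * sin w ->
  G_converges 0 nu lam /\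
  G 0 nu lam =
    (Gamma_integral nu * r `^ (- (nu + 1)) * cos ((nu + 1) * w)) +i*
    (- (Gamma_integral nu * r `^ (- (nu + 1)) * sin ((nu + 1) * w))).
Proof.
case: lam => a b nu0 r0 wpi /= ha hb.
(* This phase cancels the factor e^(i(nu+1)w) built into [rotated]; a further
   pi/2 turns the real part into the imaginary part. *)
pose psi := (nu + 1) * w.
have ReE (z : R) : 0 <= z -> complex.Re (G_integrand 0 nu (a +i* b) z) =
    rotated nu r psi w z.
  move=> z0; rewrite /G_integrand /cexp /rotated /rotated_phase /= add0r invr1 powRr1 //.
  rewrite !(mulr0, mul0r, subr0, addr0, oppr0, sub0r) -hb -ha cosN.
  rewrite mulrC -mulrA ?add0r; congr (_ * (expR _ * cos _)); rewrite /psi; ring.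
have ImE (z : R) : 0 <= z -> complex.Im (G_integrand 0 nu (a +i* b) z) =
    rotated nu r (psi + pi / 2) w z.
  move=> z0; rewrite /G_integrand /cexp /rotated /rotated_phase /= add0r invr1 powRr1 //.
  rewrite !(mulr0, mul0r, subr0, addr0, oppr0, sub0r) -hb -ha sinN -cosDpihalf.
  rewrite mulrC -mulrA ?add0r; congr (_ * (expR _ * cos _)); rewrite /psi; ring.
have eqI (f g : R -> R) : (forall z, 0 <= z -> f z = g z) ->
    {in `[0, +oo[%classic, f =1 g}.
  by move=> fg z; rewrite inE/= in_itv/= andbT => z0; exact: fg.
split.
  split.
    apply: eq_integrable (integrable_rotated psi nu0 r0 wpi) => // z zI.
    by congr EFin; rewrite -(eqI _ _ ReE).
  apply: eq_integrable (integrable_rotated (psi + pi / 2) nu0 r0 wpi) => // z zI.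
  by congr EFin; rewrite -(eqI _ _ ImE).
have iRe : \int[mu]_(z in `[0, +oo[) complex.Re (G_integrand 0 nu (a +i* b) z) =
    \int[mu]_(z in `[0, +oo[) rotated nu r psi w z.
  by apply: eq_Rintegral; exact: eqI ReE.
have iIm : \int[mu]_(z in `[0, +oo[) complex.Im (G_integrand 0 nu (a +i* b) z) =
    \int[mu]_(z in `[0, +oo[) rotated nu r (psi + pi / 2) w z.
  by apply: eq_Rintegral; exact: eqI ImE.
rewrite /G /cintegral iRe iIm !integral_rotated // Gamma_integral_scale // cosDpihalf.
by congr (_ +i* _); rewrite /psi; ring.
Qed.

End ClosedForm.

(** * Crests of the sine and local inverses *)

Section Trigonometry.
Context {R : realType}.

Lemma sinD2pin (x : R) n : sin (x + 2 * pi * n%:R) = sin x.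
Proof.
by rewrite mulr_natr mulr_natl (periodicn (@sinD2pi R)).
Qed.

Lemma cosD2pin (x : R) n : cos (x + 2 * pi * n%:R) = cos x.
Proof.
by rewrite mulr_natr mulr_natl (periodicn (@cosD2pi R)).
Qed.

Lemma sin_crest (x : R) : 0 < x -> cos x = 0 -> 0 < sin x ->
  exists n : nat, x = pi / 2 + 2 * pi * n%:R.
Proof.
move=> x0 cx sx; have pi0 := @pi_gt0 R.
have p2 : 0 < 2 * pi :> R by rewrite mulr_gt0.
pose n := Num.trunc (x / (2 * pi)); exists n.
have /truncn_itv : 0 <= x / (2 * pi) by rewrite divr_ge0 // ltW.
rewrite -/n ler_pdivlMr // ltr_pdivrMr // -[n.+1%:R]natr1 => /andP[nx xn].
pose y := x - 2 * pi * n%:R.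
have xE : x = y + 2 * pi * n%:R by rewrite /y subrK.
have [y0 y2] : 0 <= y /\ y < 2 * pi by rewrite /y; split; lra.
move: cx sx; rewrite xE cosD2pin sinD2pin => cy sy; congr (_ + _).
have ypi : y <= pi.
  rewrite leNgt; apply/negP => piy.
  have : 0 < sin (y - pi) by rewrite sin_gt0_pi // subr_gt0 piy /=; lra.
  by move: sy; rewrite -{1}(subrK pi y) sinDpi; lra.
apply: cos_inj; rewrite ?in_itv/= ?cos_pihalf //.
- by rewrite y0.
- by apply/andP; split; lra.
Qed.

End Trigonometry.

Section LocalInverse.
Context {R : realType}.

(** On a small closed interval f is strictly decreasing, hence injective, and its
    image contains a neighbourhood of f x0 by the intermediate value theorem. *)
Lemma local_inverse (f df : R -> R) (x0 : R) :
  (\forall x \near x0, is_derive (x : R) 1 f (df x) /\ df x < 0) ->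
  exists g : R -> R,
    (\forall x \near x0, g (f x) = x) /\
    (\forall y \near f x0, f (g y) = y /\ is_derive (y : R) 1 g (df (g y))^-1).
Proof.
move=> [e /= e0 He].
pose a := x0 - e / 2; pose b := x0 + e / 2.
have ab : a < b by rewrite /a /b; lra.
have inball (x : R) : x \in `[a, b] -> is_derive x 1 f (df x) /\ df x < 0.
  rewrite in_itv/= /a /b => /andP[ax xb]; apply: He => /=.
  by rewrite ltr_distl; lra.
have sub x : x \in `]a, b[ -> x \in `[a, b] by exact: subset_itv_oo_cc.
have cf : {within `[a, b], continuous f}.
  apply: derivable_within_continuous => x /inball[d _]; exact: ex_derive.
have decf : {in `[a, b] &, {homo f : x y /~ x < y}}.
  apply: ltr0_derive1_lt_cc => // x /sub/inball[d d0]; first exact: ex_derive.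
  by rewrite derive1E derive_val.
have injf : {in `[a, b] &, injective f}.
  move=> x y xab yab fxy; have [xy|yx|//] := ltgtP x y.
    by have := decf y x yab xab xy; rewrite fxy ltxx.
  by have := decf x y xab yab yx; rewrite fxy ltxx.
pose g y := xget x0 [set x | x \in `[a, b] /\ f x = y].
have gK x : x \in `[a, b] -> g (f x) = x.
  move=> xab; rewrite /g; case: xgetP => [z _ /= [zab fz]|/(_ x)/=]; last by case.
  exact: injf.
have x0ab : x0 \in `]a, b[ by rewrite in_itv/= /a /b; lra.
have neargK x : x \in `]a, b[ -> \forall z \near x, g (f z) = z.
  move=> xab; near=> z; apply: gK; apply: sub; near: z.
  exact: near_in_itvoo.
have dg (x : R) : x \in `]a, b[ -> is_derive (f x) 1 g (df x)^-1.
  move=> xab; have [dfx dfx0] := inball x (sub x xab).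
  apply: (is_derive_inverse (neargK x xab) _ dfx); last by rewrite lt_eqF.
  near=> z; have zab : z \in `]a, b[ by near: z; exact: near_in_itvoo.
  by apply: is_derive_continuous; exact: (inball z (sub z zab)).1.
exists g; split; first exact: neargK.
have [fb fa] : f b < f x0 /\ f x0 < f a.
  have [aI bI] : a \in `[a, b] /\ b \in `[a, b] by rewrite !in_itv/= !lexx ltW.
  move: (x0ab); rewrite in_itv/= => /andP[ax bx].
  by split; apply: decf => //; exact: sub.
near=> y.
have : y \in `](f b), (f a)[.
  by near: y; apply: near_in_itvoo; rewrite in_itv/= fb fa.
rewrite in_itv/= => /andP[fby yfa].
have [] := @IVT _ f a b y (ltW ab) cf.
  have fbfa := lt_trans fby yfa.
  by rewrite ge_min le_max (ltW fby) (ltW yfa) orbT.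
move=> x xab fx; rewrite -fx gK //; split => //; apply: dg.
move: xab; rewrite !in_itv/= !le_eqVlt => /andP[/predU1P[ax|->] /predU1P[bx|->]] //.
- by move: yfa; rewrite -fx -ax ltxx.
- by move: yfa; rewrite -fx -ax ltxx.
- by move: fby; rewrite -fx bx ltxx.
Unshelve. all: end_near. Qed.

End LocalInverse.

(** * The characteristic equation for real theta as a curve *)

Section CharacteristicCurve.
Context {R : realType}.
Variable nu : R.
Hypothesis nu0 : 0 <= nu.

Local Notation Gam := (Gamma_integral nu).
Local Notation s1 w := (sin ((nu + 1) * w)).
Local Notation c1 w := (cos ((nu + 1) * w)).
Local Notation s2 w := (sin ((nu + 1) * w + w)).

Lemma char_solution_polar (theta r w : R) (lam : R[i]) : 0 < r ->
  - (pi / 2) < w < pi / 2 ->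
  1 + complex.Re lam = r * cos w -> complex.Im lam = r * sin w ->
  char_solution 0 nu theta%:C lam <->
  (theta * (r * cos w - 1) + Gam * r `^ (- (nu + 1)) * c1 w = 0 /\
   theta * (r * sin w) = Gam * r `^ (- (nu + 1)) * s1 w).
Proof.
move=> r0 wpi ha hb; have [Gc GE] := G_polar nu0 r0 wpi ha hb.
rewrite /char_solution GE; case: lam ha hb {Gc GE} (Gc) => a b /= ha hb Gc.
have -> : r * cos w - 1 = a by rewrite -ha addrC addKr.
rewrite -hb; split=> [[_ /eqP]|[e1 e2]].
  rewrite eq_complex /= !mul0r subr0 addr0 => /andP[/eqP e1 /eqP e2].
  by split => //; apply/eqP; rewrite -subr_eq0 e2.
split => //; apply/eqP; rewrite eq_complex /= !mul0r subr0 addr0 e1 e2.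
by rewrite subrr eqxx.
Qed.

Lemma polar_coordinates (lam : R[i]) : -1 < complex.Re lam ->
  let w := atan (complex.Im lam / (1 + complex.Re lam)) in
  exists2 r, 0 < r &
    1 + complex.Re lam = r * cos w /\ complex.Im lam = r * sin w.
Proof.
case: lam => a b /= a1; have a0 : 0 < 1 + a by lra.
set w := atan _.
have cw : 0 < cos w by rewrite cos_gt0_pihalf // atan_gtNpi2 atan_ltpi2.
exists ((1 + a) / cos w); first by rewrite divr_gt0.
split; first by rewrite divfK // gt_eqF.
rewrite mulrAC -mulrA -/(tan w) atanK mulrC divfK // gt_eqF //.
Qed.

(** These signs make r and theta, as read off from the equations, positive and
    the logarithms below meaningful. Here s1, c1 and s2 are sin((nu+1)w),
    cos((nu+1)w) and sin((nu+2)w). *)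
Definition admissible (w : R) : Prop :=
  [/\ - (pi / 2) < w < pi / 2, 0 < s1 w, 0 < s2 w & 0 < sin w].

(** This is Gamma(nu+1) (s2/s1)^(nu+1) s2 / sin w, with the power written through
    logarithms, which is convenient to differentiate. *)
Definition curve_theta (w : R) : R :=
  Gam * expR ((nu + 1) * (ln (s2 w) - ln (s1 w))) * (s2 w * (sin w)^-1).

Definition curve_re (w : R) : R := - (c1 w * sin w * (s2 w)^-1).

Definition curve_im (w : R) : R := s1 w * sin w * (s2 w)^-1.

Lemma powR_ratio (w : R) : admissible w ->
  (s1 w / s2 w) `^ (- (nu + 1)) = expR ((nu + 1) * (ln (s2 w) - ln (s1 w))).
Proof.
move=> [_ s1w s2w _]; rewrite /powR gt_eqF ?divr_gt0 //.
by rewrite lnM ?posrE ?invr_gt0 // lnV ?posrE //; congr expR; ring.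
Qed.

Lemma curve_polar (w : R) : admissible w ->
  1 + curve_re w = s1 w / s2 w * cos w /\ curve_im w = s1 w / s2 w * sin w.
Proof.
move=> [_ _ s2w _]; have s20 : s2 w != 0 by rewrite gt_eqF.
split; last by rewrite /curve_im; ring.
rewrite /curve_re; apply: (mulIf s20).
rewrite mulrDl mulNr mul1r divfK // mulrAC divfK // sinD; ring.
Qed.

(** Multiplying the first equation by s1, the second by c1 and adding eliminates
    the right-hand side and leaves r s2 = s1 by the addition formula; the second
    equation then gives theta. *)
Lemma polar_char_curve (theta r w : R) : admissible w -> 0 < r -> 0 < theta ->
  (theta * (r * cos w - 1) + Gam * r `^ (- (nu + 1)) * c1 w = 0 /\
   theta * (r * sin w) = Gam * r `^ (- (nu + 1)) * s1 w) <->
  (r = s1 w / s2 w /\ theta = curve_theta w).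
Proof.
move=> adm r0 theta0; have [wpi s1w s2w sw] := adm.
have [s1n s2n sn] : [/\ s1 w != 0, s2 w != 0 & sin w != 0] by rewrite !gt_eqF.
have s2E : s2 w = s1 w * cos w + c1 w * sin w by rewrite sinD.
set K := Gam * _; split=> [[e1 e2]|[rE ->]].
  have rE : r = s1 w / s2 w.
    apply: (mulIf s2n); rewrite divfK //; apply: (mulfI (lt0r_neq0 theta0)).
    apply/eqP; rewrite -subr_eq0; apply/eqP.
    have -> : theta * (r * s2 w) - theta * s1 w =
      (theta * (r * cos w - 1) + K * c1 w) * s1 w +
      (theta * (r * sin w) - K * s1 w) * c1 w by rewrite s2E; ring.
    by rewrite e1 e2 subrr !mul0r addr0.
  split => //; rewrite /curve_theta -powR_ratio // -rE -/K.
  apply: (mulIf sn); rewrite mulrA divfK //.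
  apply: (mulIf (lt0r_neq0 r0)).
  rewrite -mulrA [sin w * r]mulrC e2 -[in RHS]mulrA [s2 w * r]mulrC rE.
  by rewrite divfK.
have KE : K = Gam * expR ((nu + 1) * (ln (s2 w) - ln (s1 w))).
  by rewrite /K rE powR_ratio.
rewrite /curve_theta -KE rE; split; last by field; rewrite s2n sn.
have -> : s1 w / s2 w * cos w - 1 = - (c1 w * sin w) / s2 w.
  apply: (mulIf s2n); rewrite divfK // mulrBl mul1r mulrAC divfK // s2E; ring.
by field; rewrite s2n sn.
Qed.

Lemma curve_theta_gt0 (w : R) : admissible w -> 0 < curve_theta w.
Proof.
move=> [_ _ s2w sw]; rewrite /curve_theta !mulr_gt0 ?expR_gt0 ?invr_gt0 //.
exact: Gamma_integral_gt0.
Qed.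

Lemma char_solution_curve (w : R) : admissible w ->
  char_solution 0 nu (curve_theta w)%:C (curve_re w +i* curve_im w).
Proof.
move=> adm; have [wpi s1w s2w sw] := adm; have [re im] := curve_polar adm.
have r0 : 0 < s1 w / s2 w by rewrite divr_gt0.
apply/(char_solution_polar _ r0 wpi) => //.
by apply/polar_char_curve => //; exact: curve_theta_gt0.
Qed.

(** The converse of [char_solution_curve]: a solution determines its angle, and
    the angle determines the solution. Uniqueness of the branch rests on this. *)
Lemma char_solution_on_curve (theta : R) (lam : R[i]) :
  0 < theta -> -1 < complex.Re lam ->
  let w := atan (complex.Im lam / (1 + complex.Re lam)) in
  admissible w -> char_solution 0 nu theta%:C lam ->
  theta = curve_theta w /\ lam = curve_re w +i* curve_im w.
Proof.
move=> theta0 lam1 w adm; have [wpi _ _ _] := adm.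
have [r r0 [re im]] := polar_coordinates lam1; rewrite -/w in re im.
move=> /(char_solution_polar _ r0 wpi re im)/(polar_char_curve adm r0 theta0).
move=> [rE ->]; split => //; have [cre cim] := curve_polar adm.
apply/eqP; rewrite eq_complex; apply/andP; split; apply/eqP => /=.
  by apply: (addrI 1); rewrite cre -rE.
by rewrite cim -rE.
Qed.

Definition curve_dtheta (w : R) : R :=
  Gam * (expR ((nu + 1) * (ln (s2 w) - ln (s1 w))) *
    ((nu + 1) * ((s2 w)^-1 * (cos ((nu + 1) * w + w) * (nu + 1 + 1)) -
                 (s1 w)^-1 * (c1 w * (nu + 1))))) * (s2 w * (sin w)^-1) +
  Gam * expR ((nu + 1) * (ln (s2 w) - ln (s1 w))) *
    (cos ((nu + 1) * w + w) * (nu + 1 + 1) * (sin w)^-1 -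
     s2 w * ((sin w)^-1 * (sin w)^-1 * cos w)).

Lemma is_derive_curve_theta (w : R) : admissible w ->
  is_derive w 1 curve_theta (curve_dtheta w).
Proof.
move=> [_ s1w s2w sw]; rewrite /curve_theta /curve_dtheta.
notypeclasses refine (is_derive_eq _ _).
  notypeclasses refine (is_deriveMF _ _); last first.
    notypeclasses refine (is_deriveMF _ _); last first.
      notypeclasses refine (is_derive_invF _ _); first by rewrite gt_eqF.
      by derive_rules.
    by derive_rules.
  notypeclasses refine (is_deriveMF _ _); first by derive_rules.
  notypeclasses refine (is_derive_expRF _).
  notypeclasses refine (is_deriveMF _ _); first by derive_rules.
  notypeclasses refine (is_deriveDF _ _).
    by notypeclasses refine (is_derive_lnF s2w _); derive_rules.
  notypeclasses refine (is_deriveNF _).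
  by notypeclasses refine (is_derive_lnF s1w _); derive_rules.
by move=> /=; rewrite -exprVn; ring.
Qed.

End CharacteristicCurve.

(** * The branch through a crossing of the imaginary axis *)

Section HopfPoint.
Context {R : realType}.
Variables nu wk : R.
Hypotheses (nu0 : 0 <= nu) (wk0 : 0 < wk) (wkpi : wk < pi / 2).
Hypotheses (c1k : cos ((nu + 1) * wk) = 0) (s1k : sin ((nu + 1) * wk) = 1).

Local Notation adm := (admissible nu).
Local Notation th := (curve_theta nu).
Local Notation s2 w := (sin ((nu + 1) * w + w)).

Let wkNpi : - (pi / 2) < wk.
Proof. by apply: lt_trans wk0; rewrite oppr_lt0 divr_gt0 // pi_gt0. Qed.

Let cwk : 0 < cos wk.
Proof. by rewrite cos_gt0_pihalf // wkNpi wkpi. Qed.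

Let swk : 0 < sin wk.
Proof.
rewrite sin_gt0_pi // wk0 (lt_trans wkpi) //.
by rewrite ltr_pdivrMr // ltr_pMr ?pi_gt0 // ltr1n.
Qed.

Let s2k : s2 wk = cos wk.
Proof. by rewrite sinD s1k c1k mul1r mul0r addr0. Qed.

Let c2k : cos ((nu + 1) * wk + wk) = - sin wk.
Proof. by rewrite cosD s1k c1k mul1r mul0r sub0r. Qed.

Lemma admissible_hopf : adm wk.
Proof.
split => //; last by rewrite s2k.
- by rewrite wkNpi wkpi.
- by rewrite s1k.
Qed.

Lemma near_admissible : \forall w \near wk, adm w.
Proof.
have [wpi s1w s2w sw] := admissible_hopf.
have cs1 : {for wk, continuous (fun w => sin ((nu + 1) * w))}.
  by apply: is_derive_continuous; derive_rules.
have cs2 : {for wk, continuous (fun w => s2 w)}.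
  by apply: is_derive_continuous; derive_rules.
have cs : {for wk, continuous (@sin R)} by exact: continuous_sin.
have n0 : \forall w \near wk, w \in `](- (pi / 2)), (pi / 2)[.
  by apply: near_in_itvoo; rewrite in_itv.
near=> w; split.
- have : w \in `](- (pi / 2)), (pi / 2)[ by near: w.
  by rewrite in_itv.
- by near: w; exact: (cvgr_gt _ cs1).
- by near: w; exact: (cvgr_gt _ cs2).
- by near: w; exact: (cvgr_gt _ cs).
Unshelve. all: end_near. Qed.

(** At wk the logarithmic derivative of theta is -(nu+2)^2 tan wk - cot wk, since
    cos((nu+1)wk) = 0 and sin((nu+2)wk) = cos wk. *)
Lemma curve_dtheta_hopf_lt0 : curve_dtheta nu wk < 0.
Proof.
have G0 := Gamma_integral_gt0 nu0.
rewrite /curve_dtheta s2k c2k c1k s1k.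
set E := Gamma_integral nu * expR _.
have E0 : 0 < E by rewrite mulr_gt0 ?expR_gt0.
have -> : Gamma_integral nu * (expR ((nu + 1) * (ln (cos wk) - ln 1)) *
    ((nu + 1) * ((cos wk)^-1 * (- sin wk * (nu + 1 + 1)) - 1^-1 * (0 * (nu + 1))))) *
    (cos wk / sin wk) + E * (- sin wk * (nu + 1 + 1) / sin wk -
    cos wk * ((sin wk)^-1 * (sin wk)^-1 * cos wk)) =
    - (E * ((nu + 1) * (nu + 1 + 1) + (nu + 1 + 1) + (cos wk / sin wk) ^+ 2)).
  by rewrite /E; field; rewrite !gt_eqF.
rewrite oppr_lt0 mulr_gt0 // ltr_wpDr ?sqr_ge0 //.
by rewrite ltr_wpDl ?mulr_ge0 ?addr_ge0 // ltr_wpDl ?addr_ge0.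
Qed.

Lemma near_curve_dtheta_lt0 :
  \forall w \near wk, is_derive (w : R) 1 th (curve_dtheta nu w) /\
                      curve_dtheta nu w < 0.
Proof.
have [wpi s1w s2w sw] := admissible_hopf.
have cd : {for wk, continuous (curve_dtheta nu)}.
  rewrite /curve_dtheta; notypeclasses refine (is_derive_continuous _).
  repeat (first [ progress derive_rules
    | notypeclasses refine (is_derive_lnF s2w _)
    | notypeclasses refine (is_derive_lnF s1w _)
    | notypeclasses refine (is_derive_invF (lt0r_neq0 s1w) _)
    | notypeclasses refine (is_derive_invF (lt0r_neq0 s2w) _)
    | notypeclasses refine (is_derive_invF (lt0r_neq0 sw) _) ]).
near=> w; split.
- by apply: is_derive_curve_theta; near: w; exact: near_admissible.
- by near: w; apply: (cvgr_lt _ cd); exact: curve_dtheta_hopf_lt0.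
Unshelve. all: end_near. Qed.

Lemma curve_re_hopf : curve_re nu wk = 0.
Proof. by rewrite /curve_re c1k !mul0r oppr0. Qed.

Lemma curve_im_hopf : curve_im nu wk = tan wk.
Proof. by rewrite /curve_im s1k s2k mul1r. Qed.

Lemma is_derive_curve_re (w : R) : adm w ->
  is_derive w 1 (curve_re nu)
    (- ((- sin ((nu + 1) * w) * (nu + 1) * sin w + cos ((nu + 1) * w) * cos w) *
        (s2 w)^-1 +
        cos ((nu + 1) * w) * sin w *
        (- (s2 w ^- 2) * (cos ((nu + 1) * w + w) * (nu + 1 + 1))))).
Proof.
move=> [_ _ s2w _]; rewrite /curve_re; notypeclasses refine (is_derive_eq _ _).
  derive_rules.
  by notypeclasses refine (is_derive_invF (lt0r_neq0 s2w) _); derive_rules.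
by rewrite /=; ring.
Qed.

Lemma is_derive_curve_im (w : R) : adm w ->
  is_derive w 1 (curve_im nu)
    ((cos ((nu + 1) * w) * (nu + 1) * sin w + sin ((nu + 1) * w) * cos w) *
        (s2 w)^-1 +
        sin ((nu + 1) * w) * sin w *
        (- (s2 w ^- 2) * (cos ((nu + 1) * w + w) * (nu + 1 + 1)))).
Proof.
move=> [_ _ s2w _]; rewrite /curve_im; notypeclasses refine (is_derive_eq _ _).
  derive_rules.
  by notypeclasses refine (is_derive_invF (lt0r_neq0 s2w) _); derive_rules.
by rewrite /=; ring.
Qed.

(** Only the derivative of the vanishing factor cos((nu+1)w) contributes. *)
Lemma is_derive_curve_re_hopf :
  is_derive wk 1 (curve_re nu) ((nu + 1) * (sin wk / cos wk)).
Proof.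
apply: is_derive_eq (is_derive_curve_re admissible_hopf) _.
by rewrite c1k s1k s2k; ring.
Qed.

(** The branch is the curve composed with the local inverse g of w |-> theta. A
    competing branch lam' is continuous at the crossing, so its angle stays near
    wk; by [char_solution_on_curve] that angle is sent to theta, so it is g theta. *)
Lemma hopf_branch : exists lam : R -> R[i],
  [/\ is_branch 0 nu (th wk) (0 +i* tan wk) lam,
      (forall lam', is_branch 0 nu (th wk) (0 +i* tan wk) lam' ->
         \forall theta \near th wk, lam' theta = lam theta) &
      complex.Re (cderive1 lam (th wk)) < 0].
Proof.
have [g [gK gV]] := local_inverse near_curve_dtheta_lt0.
have gk : g (th wk) = wk by exact: nbhs_singleton gK.
have dgk : is_derive (th wk) 1 g (curve_dtheta nu wk)^-1.
  by have [_] := nbhs_singleton gV; rewrite gk.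
have cg : g theta @[theta --> th wk] --> wk.
  by rewrite -[X in _ --> X]gk; exact: is_derive_continuous dgk.
have near_adm : \forall theta \near th wk, adm (g theta).
  exact: cg near_admissible.
exists (fun theta => curve_re nu (g theta) +i* curve_im nu (g theta)); split.
- split; first by rewrite gk curve_re_hopf curve_im_hopf.
  near=> theta.
  have admg : adm (g theta) by near: theta.
  have [thE dg] : th (g theta) = theta /\
    is_derive theta 1 g (curve_dtheta nu (g theta))^-1 by near: theta.
  split; last by rewrite -{1}thE; exact: char_solution_curve.
  split.
    exact: is_derive_derivable (is_derive_compF (is_derive_curve_re admg) dg).
  exact: is_derive_derivable (is_derive_compF (is_derive_curve_im admg) dg).
- move=> lam' [lam'k lam'near].
  have [[dre dim] _] := nbhs_singleton lam'near.
  have cre : complex.Re (lam' theta) @[theta --> th wk] --> (0 : R).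
    rewrite [X in _ --> X](_ : _ = complex.Re (lam' (th wk))); last by rewrite lam'k.
    exact: derivable_continuous dre.
  have cim : complex.Im (lam' theta) @[theta --> th wk] --> tan wk.
    rewrite [X in _ --> X](_ : _ = complex.Im (lam' (th wk))); last by rewrite lam'k.
    exact: derivable_continuous dim.
  pose w theta := atan (complex.Im (lam' theta) / (1 + complex.Re (lam' theta))).
  have cw : w theta @[theta --> th wk] --> wk.
    have wE : wk = atan (tan wk / (1 + 0)).
      by rewrite addr0 divr1 tanK // in_itv/= wkNpi wkpi.
    rewrite [X in _ --> X]wE.
    apply: continuous_cvg; first exact: continuous_atan.
    apply: cvgM => //; apply: cvgV; first by rewrite addr0 oner_neq0.
    by apply: cvgD => //; exact: cvg_cst.
  near=> theta.
  have [_ chi] : cderivable lam' theta /\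
    char_solution 0 nu theta%:C (lam' theta) by near: theta.
  have theta0 : 0 < theta.
    by near: theta; apply: lt_nbhsr; exact: curve_theta_gt0 admissible_hopf.
  have re1 : -1 < complex.Re (lam' theta).
    by near: theta; apply: (cvgr_gt _ cre); rewrite ltrN10.
  have admw : adm (w theta) by near: theta; exact: cw near_admissible.
  have [thE ->] := char_solution_on_curve nu0 theta0 re1 admw chi.
  suff -> : g theta = w theta by [].
  rewrite {1}thE -/(w theta).
  by near: theta; exact: cw gK.
- rewrite /cderive1 /= derive1E.
  have dre := is_derive_curve_re_hopf; rewrite -gk in dre.
  rewrite (derive_val (is_derive := is_derive_compF dre dgk)) gk.
  rewrite pmulr_rlt0 ?invr_lt0 ?curve_dtheta_hopf_lt0 //.
  by rewrite mulr_gt0 ?divr_gt0 // ltr_wpDl.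
Unshelve. all: end_near. Qed.

End HopfPoint.

(** * Eigenvalues on the imaginary axis *)

Section ImaginaryAxis.
Context {R : realType}.
Implicit Types nu t eta theta : R.

Lemma cos_atan_gt0 t : 0 < cos (atan t).
Proof. by rewrite cos_gt0_pihalf // atan_gtNpi2 atan_ltpi2. Qed.

Lemma sin_atan t : (cos (atan t))^-1 * sin (atan t) = t.
Proof. by rewrite mulrC -/(tan _) atanK. Qed.

(** Here r = 1 / cos(atan t), so r^-(nu+1) is a power of cos(atan t), written as an
    exponential. *)
Lemma G_imaginary nu t : 0 <= nu ->
  complex.Re (G 0 nu (0 +i* t)) =
  Gamma_integral nu * expR ((nu + 1) * ln (cos (atan t))) * cos ((nu + 1) * atan t).
Proof.
move=> nu0; have ct := cos_atan_gt0 t.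
have r0 : 0 < (cos (atan t))^-1 by rewrite invr_gt0.
have wpi : - (pi / 2) < atan t < pi / 2 by rewrite atan_gtNpi2 atan_ltpi2.
have [||_ ->] := @G_polar _ nu _ _ (0 +i* t) nu0 r0 wpi.
- by rewrite /= addr0 mulVf // gt_eqF.
- by rewrite /= sin_atan.
rewrite /= /powR gt_eqF // lnV ?posrE //; congr (_ * expR _ * _); ring.
Qed.

Lemma char_solution_imaginary nu theta t : 0 <= nu ->
  let K := Gamma_integral nu * (cos (atan t))^-1 `^ (- (nu + 1)) in
  char_solution 0 nu theta%:C (0 +i* t) <->
  K * cos ((nu + 1) * atan t) = 0 /\ theta * t = K * sin ((nu + 1) * atan t).
Proof.
move=> nu0 K; have ct := cos_atan_gt0 t.
have r0 : 0 < (cos (atan t))^-1 by rewrite invr_gt0.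
have wpi : - (pi / 2) < atan t < pi / 2 by rewrite atan_gtNpi2 atan_ltpi2.
have rc : (cos (atan t))^-1 * cos (atan t) = 1 by rewrite mulVf // gt_eqF.
have := @char_solution_polar _ nu nu0 theta _ _ (0 +i* t) r0 wpi.
rewrite /= addr0 rc sin_atan subrr mulr0 add0r -/K; exact.
Qed.

Lemma vartheta_real nu eta : 0 <= nu -> 0 < eta ->
  vartheta 0 nu eta = (eta * Gamma_integral nu)%:C.
Proof.
move=> nu0 eta0; have pi0 := @pi_gt0 R.
have wpi : - (pi / 2) < (0 : R) < pi / 2 by lra.
have [||_ GE] := @G_polar _ nu 1 0 0 nu0 ltr01 wpi.
- by rewrite /= cos0 mulr1 addr0.
- by rewrite /= sin0 mulr0.
rewrite /vartheta GE add0r invr1 powRr1 ?ltW // powR1 mulr0 cos0 sin0.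
by rewrite !mulr1 mulr0 oppr0 -rmorphM.
Qed.

Lemma omegaE nu (n : nat) : 0 <= nu ->
  (nu + 1) * omega nu n = pi / 2 + 2 * pi * n%:R.
Proof.
move=> nu0; have n1 : 1 + nu != 0 by rewrite gt_eqF // ltr_pwDl.
by rewrite /omega -pmulrn; field.
Qed.

Lemma omega_bounds nu (n : nat) : 0 <= nu -> 4 * n%:R < nu ->
  0 < omega nu n < pi / 2.
Proof.
move=> nu0 nnu; have n1 : 0 < 1 + nu by rewrite ltr_pwDl.
have pi20 : 0 < pi / 2 :> R by rewrite divr_gt0 // pi_gt0.
rewrite /omega -pmulrn; apply/andP; split.
  by rewrite (mulr_gt0 pi20) // divr_gt0 // ltr_pwDl // mulr_ge0.
by rewrite gtr_pMr // ltr_pdivrMr // mul1r ltrD2l.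
Qed.

Lemma omega_crest nu (n : nat) : 0 <= nu ->
  cos ((nu + 1) * omega nu n) = 0 /\ sin ((nu + 1) * omega nu n) = 1.
Proof. by move=> nu0; rewrite omegaE // cosD2pin sinD2pin cos_pihalf sin_pihalf. Qed.

Lemma nonneg_int_nat (k : int) : (0 : R) <= 4 * k%:~R -> exists n : nat, k = n.
Proof. by rewrite pmulr_rge0 // ler0z; case: k => // n _; exists n. Qed.

(** With w = atan t, the real part forces cos((nu+1)w) = 0 and the imaginary part
    sin((nu+1)w) > 0, that is (nu+1)w = pi/2 + 2 pi n; then w < pi/2 amounts to
    4n < nu. Conversely the imaginary part is solved for eta. *)
Lemma eigenvalue_iff nu t : 0 <= nu -> 0 < t ->
  ((exists eta : R, 0 < eta /\ is_eigenvalue 0 nu eta (0 +i* t)) <->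
   (exists k : int, (0 : R) <= 4 * k%:~R < nu /\ atan t = omega nu k)).
Proof.
move=> nu0 t0; have G0 := Gamma_integral_gt0 nu0.
have ct := cos_atan_gt0 t.
set K := Gamma_integral nu * (cos (atan t))^-1 `^ (- (nu + 1)).
have K0 : 0 < K by rewrite mulr_gt0 // powR_gt0 // invr_gt0.
have n1 : 0 < nu + 1 by rewrite ltr_wpDl.
have at0 : 0 < atan t.
  have st : 0 < sin (atan t).
    have ict : 0 < (cos (atan t))^-1 by rewrite invr_gt0.
    by rewrite -(pmulr_rgt0 _ ict) sin_atan.
  rewrite ltNge; apply/negP => a0; move: st; rewrite ltNge => /negP; apply.
  rewrite -[atan t]opprK sinN oppr_le0 sin_ge0_pi // oppr_ge0 a0 /=.
  have := atan_gtNpi2 t; have := @pi_gt0 R; rewrite lerNl; set p := pi; lra.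
split=> [[eta [eta0]]|[k [/andP[k0 knu] wk]]].
  rewrite /is_eigenvalue vartheta_real // => /(char_solution_imaginary _ _ nu0).
  rewrite -/K => -[/eqP]; rewrite mulf_eq0 gt_eqF //= => /eqP c0 e.
  have s0 : 0 < sin ((nu + 1) * atan t).
    by rewrite -(pmulr_rgt0 _ K0) -e !mulr_gt0.
  have [n nE] := sin_crest (mulr_gt0 n1 at0) c0 s0.
  have wE : atan t = omega nu n.
    by apply: (mulfI (lt0r_neq0 n1)); rewrite nE omegaE.
  exists n; split => //; rewrite -pmulrn mulr_ge0 //=.
  have : (nu + 1) * atan t < (nu + 1) * (pi / 2).
    by rewrite (ltr_pM2l n1) atan_ltpi2.
  by rewrite nE -(ltr_pM2r (@pi_gt0 R)); lra.
have [n kn] := nonneg_int_nat k0; rewrite kn in wk.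
have [c1 s1] := omega_crest n nu0.
have eta0 : 0 < K / (Gamma_integral nu * t).
  by apply: divr_gt0 => //; exact: mulr_gt0.
exists (K / (Gamma_integral nu * t)); split => //.
rewrite /is_eigenvalue vartheta_real //.
apply/(char_solution_imaginary _ _ nu0); rewrite -/K wk c1 s1 mulr0 mulr1.
by split => //; field; rewrite !gt_eqF.
Qed.

(** The factor cos((nu+1) atan t) vanishes at tan wk, so only its derivative
    contributes; its slope is negative because sin((nu+1)wk) = 1. *)
Lemma is_derive_Re_G nu wk : 0 <= nu -> - (pi / 2) < wk < pi / 2 ->
  cos ((nu + 1) * wk) = 0 -> sin ((nu + 1) * wk) = 1 ->
  exists2 D : R, D < 0 &
    is_derive (tan wk) 1 (fun t : R => complex.Re (G 0 nu (0 +i* t))) D.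
Proof.
move=> nu0 wkpi c1 s1; have wE : atan (tan wk) = wk by rewrite tanK ?in_itv.
have G0 := Gamma_integral_gt0 nu0.
have cwk : 0 < cos (atan (tan wk)) by exact: cos_atan_gt0.
exists (- (Gamma_integral nu * expR ((nu + 1) * ln (cos wk)) *
        ((nu + 1) * (1 + tan wk ^+ 2)^-1))).
  rewrite oppr_lt0; apply: mulr_gt0; first by rewrite mulr_gt0 ?expR_gt0.
  apply: mulr_gt0; first by rewrite ltr_wpDl.
  by rewrite invr_gt0 ltr_pwDl ?sqr_ge0.
have GE : (fun t : R => complex.Re (G 0 nu (0 +i* t))) = (fun t : R =>
    Gamma_integral nu * expR ((nu + 1) * ln (cos (atan t))) *
    cos ((nu + 1) * atan t)).
  by apply/funext => t; exact: G_imaginary.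
rewrite GE.
notypeclasses refine (is_derive_eq _ _).
  notypeclasses refine (is_deriveMF _ _).
    notypeclasses refine (is_deriveMF _ _); first by derive_rules.
    notypeclasses refine (is_derive_expRF _).
    notypeclasses refine (is_deriveMF _ _); first by derive_rules.
    notypeclasses refine (is_derive_lnF cwk _).
    notypeclasses refine (is_derive_cosF _); exact: is_derive1_atan.
  notypeclasses refine (is_derive_cosF _).
  notypeclasses refine (is_deriveMF _ _); first by derive_rules.
  exact: is_derive1_atan.
by rewrite /= wE c1 s1; ring.
Qed.

End ImaginaryAxis.

Unset Implicit Arguments.

Theorem mainTheorem2 (R : realType) (nu : R) (hnu : 0 <= nu) :
  (forall t : R, 0 < t ->
     ((exists eta : R, 0 < eta /\ is_eigenvalue 0 nu eta (0 +i* t)) <->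
      (exists k : int, (0 : R) <= 4 * k%:~R < nu /\ atan t = omega nu k)))
  /\
  (forall k : int, (0 : R) <= 4 * k%:~R < nu ->
     (* the order of R[i]: theta_ nu k is real and positive *)
     (0 : R[i]) < theta_ nu k /\
     derivable (fun t : R => complex.Re (G 0 nu (0 +i* t))) (t_ nu k) 1 /\
     derive1 (fun t : R => complex.Re (G 0 nu (0 +i* t))) (t_ nu k) <> 0 /\
     exists lam : R -> R[i],
       is_branch 0 nu (complex.Re (theta_ nu k)) (0 +i* t_ nu k) lam /\
       (forall lam' : R -> R[i],
          is_branch 0 nu (complex.Re (theta_ nu k)) (0 +i* t_ nu k) lam' ->
          \forall theta \near complex.Re (theta_ nu k), lam' theta = lam theta) /\
       complex.Re (cderive1 lam (complex.Re (theta_ nu k))) < 0).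
Proof.
split; first by move=> t; exact: eigenvalue_iff.
move=> k /andP[k0]; have [n ->] := nonneg_int_nat k0; rewrite -pmulrn => nnu.
have /andP[w0 wpi] := omega_bounds hnu nnu.
have [c1 s1] := omega_crest n hnu.
have wNpi : - (pi / 2) < omega nu n.
  by apply: lt_trans w0; rewrite oppr_lt0 divr_gt0 // pi_gt0.
have adm := admissible_hopf w0 wpi c1 s1.
have t0 : 0 < t_ nu n.
  rewrite /t_ /tan divr_gt0 //; first by have [] := adm.
  by rewrite cos_gt0_pihalf // wNpi.
(* The curve passes through the imaginary axis at this angle, and solving its
   characteristic equation for theta gives the number theta_. *)
have thE : theta_ nu n = (curve_theta nu (omega nu n))%:C.
  have [_] := char_solution_curve hnu adm.
  rewrite (curve_re_hopf c1) (curve_im_hopf c1 s1) -/(t_ nu n) => /eqP.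
  rewrite addr_eq0 eq_sym eqr_oppLR => /eqP GE.
  rewrite /theta_ GE opprK mulfK //.
  by rewrite eq_complex /= negb_and (gt_eqF t0) orbT.
have [D D0 dG] : exists2 D : R, D < 0 &
    is_derive (t_ nu n) 1 (fun t : R => complex.Re (G 0 nu (0 +i* t))) D.
  by apply: is_derive_Re_G; rewrite ?wNpi.
rewrite thE /=; split; first by rewrite ltcR; exact: curve_theta_gt0.
split; first exact: is_derive_derivable dG.
split; first by rewrite derive1E (derive_val (is_derive := dG)); apply/eqP; rewrite lt_eqF.
have [lam [branch uniq lt0]] := hopf_branch hnu w0 wpi c1 s1.
by exists lam.
Qed.
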